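(* Let $n_1\le n_2$ be positive even integers such that either $n_1<n_2$ or $n_1=n_2\notin\{4,8,12,16\}$. Let $I(n_1,n_2)=\{1,\dots,n_1\}\times\{1,\dots,n_2\}$ be equipped with the $L_1$ metric $d((x_1,x_2),(y_1,y_2))=|x_1-y_1|+|x_2-y_2|$, and let $N$ be the set of unordered pairs $\{x,y\}$ of elements of $I(n_1,n_2)$ with $d(x,y)=1$. For a permutation $\pi$ of $I(n_1,n_2)$, let $$f(\pi)=\sum_{\{x,y\}\in N}d(\pi(x),\pi(y)).$$ Then the set $\mathcal P(n_1,n_2)$ of permutations (defined in the context) is nonempty, the function $f$ attains its maximum over all permutations of $I(n_1,n_2)$ at $\pi$ if and only if $\pi\in\mathcal P(n_1,n_2)$, and this maximum is equal to $$n_1n_2(n_1+n_2)-4-n_1-w_{2n_1+2n_2-4}(n_1,n_2).$$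
   Context: Write $n_1=2t_1$, $n_2=2t_2$, $I=I(n_1,n_2)$. For $x\in I$ write $x=(x_1,x_2)$; the first coordinate is the row and the second the column. Grids are displayed with matrix coordinates, so a vertical line separates columns and a horizontal line separates rows. For $i\in\{1,2\}$ a value $u\in\{1,\dots,n_i\}$ of the $i$th coordinate is called small if $u\le t_i$ and large if $u>t_i$. An element $(a,b)\in I$ is homogeneous if $a$, $b$ are both small or both large, and heterogeneous otherwise. Let $O=((n_1+1)/2,(n_2+1)/2)$, let $d(x,O)$ be the $L_1$ distance, and for $A\subseteq I$ let $w(A)=\sum_{x\in A}d(x,O)$. Let $w_k(n_1,n_2)=\min\{w(A): A\subseteq I,\ |A|=k\}$ and $\Lambda_1=\{x\in I: d(x,O)=1\}=\{t_1,t_1+1\}\times\{t_2,t_2+1\}$. For a permutation $\pi$ of $I$, let $C=\{\pi(1,1),\pi(1,n_2),\pi(n_1,1),\pi(n_1,n_2)\}$ be the set of values at the four corners, and let $B=\{\pi(i,j): i\in\{1,n_1\}\text{ or }j\in\{1,n_2\}\}\setminus C$ be the set of values on the rest of the boundary. For $i\in\{1,2\}$ define the defect multisets (one entry for each qualifying pair $\{x,y\}\in N$): $D_i^<$ consists of $\max\{\pi(x)_i,\pi(y)_i\}$ over all $\{x,y\}\in N$ with $\pi(x)_i$ and $\pi(y)_i$ both small; $D_i^>$ consists of $\min\{\pi(x)_i,\pi(y)_i\}$ over all $\{x,y\}\in N$ with $\pi(x)_i$ and $\pi(y)_i$ both large. The set $\mathcal P(n_1,n_2)$ (for $n_1\le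 n_2$) consists of all permutations $\pi$ of $I$ satisfying all of the following conditions: (1) $C=\Lambda_1$; (2) the grid is cut into two equal halves by the vertical line between columns $t_2$ and $t_2+1$ (or, when $n_1=n_2$, either by that vertical line or by the horizontal line between rows $t_1$ and $t_1+1$), so that all values of $\pi$ on one half are homogeneous, all values of $\pi$ on the other half are heterogeneous, and whenever $\{x,y\}\in N$ with $x,y$ in the same half, then for both $i=1$ and $i=2$ exactly one of $\pi(x)_i,\pi(y)_i$ is small; (3) for each $i\in\{1,2\}$, every element of $D_i^>$ is equal to $t_i+1$ and every element of $D_i^<$ is equal to $t_i$; (4) $B\cup C$ satisfies $w(B\cup C)=w_{2n_1+2n_2-4}(n_1,n_2)$, where $|B\cup C|=2n_1+2n_2-4$. *)

(* Defs.v *)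
From mathcomp Require Import all_boot all_order all_algebra all_fingroup.
From mathcomp Require Import zify.

Set Implicit Arguments.
Unset Strict Implicit.
Unset Printing Implicit Defensive.

Import Order.TTheory GRing.Theory Num.Theory.

Local Open Scope ring_scope.

(* Ordinals start at 0, so (i, j) : grid n1 n2 stands for the point
   (i + 1, j + 1) of {1..n1} x {1..n2}; all formulas below go through [coord],
   which returns the 1-based coordinates. *)
Definition grid (n1 n2 : nat) := ('I_n1 * 'I_n2)%type.

Variant axis := Row | Col.

Definition extent (n1 n2 : nat) (i : axis) : nat :=
  match i with Row => n1 | Col => n2 end.

Definition half (n1 n2 : nat) (i : axis) : nat := (extent n1 n2 i)./2.

Definition coord (n1 n2 : nat) (i : axis) (x : grid n1 n2) : nat :=
  match i with Row => (x.1).+1 | Col => (x.2).+1 end.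

Definition pos (n1 n2 : nat) (x : grid n1 n2) : rat * rat :=
  ((coord Row x)%:R, (coord Col x)%:R).

Definition dist (p q : rat * rat) : rat := `|p.1 - q.1| + `|p.2 - q.2|.

Definition center (n1 n2 : nat) : rat * rat :=
  ((n1%:R + 1) / 2, (n2%:R + 1) / 2).

(* Each unordered pair {x, y} with d(x, y) = 1 is represented once, by the
   ordered pair whose second component is the right or lower neighbour of the
   first (see [edges_orient]). *)
Definition edges (n1 n2 : nat) : {set grid n1 n2 * grid n1 n2} :=
  [set e | [&& dist (pos e.1) (pos e.2) == 1,
               (coord Row e.1 <= coord Row e.2)%N
             & (coord Col e.1 <= coord Col e.2)%N]].

Definition f (n1 n2 : nat) (s : {perm grid n1 n2}) : rat :=
  \sum_(e in edges n1 n2) dist (pos (s e.1)) (pos (s e.2)).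

Definition weight (n1 n2 : nat) (A : {set grid n1 n2}) : rat :=
  \sum_(x in A) dist (pos x) (center n1 n2).

(* The default value weight setT is an upper bound of all weights, so this is
   the minimum over the sets of cardinal k as soon as k <= n1 * n2
   (see [min_weightP]). *)
Definition min_weight (n1 n2 k : nat) : rat :=
  \big[Order.min/weight [set: grid n1 n2]]_(A : {set grid n1 n2} | #|A| == k)
    weight A.

Definition Lambda1 (n1 n2 : nat) : {set grid n1 n2} :=
  [set x | dist (pos x) (center n1 n2) == 1].

Definition small (n1 n2 : nat) (i : axis) (x : grid n1 n2) : bool :=
  (coord i x <= half n1 n2 i)%N.

Definition homogeneous (n1 n2 : nat) (x : grid n1 n2) : bool :=
  small Row x == small Col x.

Definition extremal (n1 n2 : nat) (i : axis) (x : grid n1 n2) : bool :=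
  (coord i x == 1%N) || (coord i x == extent n1 n2 i).

Definition corner_values (n1 n2 : nat) (s : {perm grid n1 n2}) :
    {set grid n1 n2} :=
  [set s x | x : grid n1 n2 & extremal Row x && extremal Col x].

Definition border_values (n1 n2 : nat) (s : {perm grid n1 n2}) :
    {set grid n1 n2} :=
  [set s x | x : grid n1 n2 & extremal Row x || extremal Col x]
    :\: corner_values s.

(* Multisets of naturals, as sequences. *)
Definition defects_small (n1 n2 : nat) (s : {perm grid n1 n2}) (i : axis) :
    seq nat :=
  [seq maxn (coord i (s e.1)) (coord i (s e.2))
     | e <- enum (edges n1 n2) & small i (s e.1) && small i (s e.2)].

Definition defects_large (n1 n2 : nat) (s : {perm grid n1 n2}) (i : axis) :
    seq nat :=
  [seq minn (coord i (s e.1)) (coord i (s e.2))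
     | e <- enum (edges n1 n2) & ~~ small i (s e.1) && ~~ small i (s e.2)].

(* The line cutting axis a in its middle: a = Col is the vertical line between
   columns t2 and t2 + 1, a = Row the horizontal one between rows t1 and
   t1 + 1.  H is the half carrying the homogeneous values. *)
Definition split_along (n1 n2 : nat) (s : {perm grid n1 n2}) (a : axis) :
    Prop :=
  exists H : {set grid n1 n2},
    [/\ H = [set x | small a x] \/ H = [set x | ~~ small a x],
        forall x, x \in H -> homogeneous (s x),
        forall x, x \notin H -> ~~ homogeneous (s x)
      & forall e, e \in edges n1 n2 -> (e.1 \in H) = (e.2 \in H) ->
          forall i, small i (s e.1) != small i (s e.2)].

Definition optimal_family (n1 n2 : nat) (s : {perm grid n1 n2}) : Prop :=
  [/\ corner_values s = Lambda1 n1 n2,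
      split_along s Col \/ (n1 = n2 /\ split_along s Row),
      forall i u, (u \in defects_large s i -> u = (half n1 n2 i).+1) /\
                  (u \in defects_small s i -> u = half n1 n2 i)
    & weight (border_values s :|: corner_values s)
        = min_weight n1 n2 (2 * n1 + 2 * n2 - 4)].

Lemma norm_subn (m n : nat) :
  `|m%:R - n%:R| = (m - n + (n - m))%:R :> rat.
Proof.
have [le_mn|/ltnW le_nm] := leqP m n.
  by rewrite distrC ger0_norm ?subr_ge0 ?ler_nat // -natrB //; congr _%:R; lia.
by rewrite ger0_norm ?subr_ge0 ?ler_nat // -natrB //; congr _%:R; lia.
Qed.

Lemma edges_orient (n1 n2 : nat) (x y : grid n1 n2) :
  dist (pos x) (pos y) = 1 ->
  ((x, y) \in edges n1 n2) (+) ((y, x) \in edges n1 n2).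
Proof.
case: x y => [a b] [c d].
rewrite !inE /dist /pos /coord /= !norm_subn -!natrD => /eqP.
by rewrite !(eqr_nat rat _ 1); lia.
Qed.

Lemma min_weightP (n1 n2 k : nat) : (k <= n1 * n2)%N ->
  (exists2 A : {set grid n1 n2}, #|A| = k & weight A = min_weight n1 n2 k) /\
  (forall A : {set grid n1 n2}, #|A| = k -> min_weight n1 n2 k <= weight A).
Proof.
move=> hk; split; last first.
  by move=> A /eqP hA; apply: bigmin_le_cond.
have le_wT (A : {set grid n1 n2}) : weight A <= weight [set: grid n1 n2].
  rewrite /weight [leRHS](bigID (mem A)) /=.
  under [X in _ <= X + _]eq_bigl => x do rewrite inE.
  by rewrite lerDl; apply: sumr_ge0 => x _; rewrite addr_ge0.
have: (0 < #|[set A : {set grid n1 n2} | #|A| == k]|)%N.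
  have hc := card_draws (grid n1 n2 : finType) k.
  by rewrite hc card_prod !card_ord bin_gt0.
case/card_gt0P => A0; rewrite inE => hA0.
rewrite /min_weight (bigmin_eq_arg _ _ _ _ hA0) //.
by case: arg_minP => // A /eqP hA _; exists A.
Qed.

(* Main.v *)
From mathcomp Require Import all_boot all_order all_algebra all_fingroup.
From mathcomp Require Import zify lra.
Require Import Defs.

Set Implicit Arguments.
Unset Strict Implicit.
Unset Printing Implicit Defensive.

Import Order.TTheory GRing.Theory Num.Theory.

(** Write [delta] for the distance to the centre along one axis.  On one axis
    the distance of two values is the sum of their [delta]s when they lie on
    opposite sides of the centre, and falls short of it by twice the smaller
    [delta] when they lie on the same side.  Summing over the edges, a cell
    contributes its degree times the distance of its value to the centre; the
    degree is 4, minus 1 on the border, minus 1 again at the corners.  Hence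
    [f_formula]: the objective is the constant n1 n2 (n1 + n2), minus the weight
    of the corner values, minus the weight of all boundary values, minus the
    total cost of the defects.

    Each of the three losses is bounded separately.  The four corner values
    weigh at least 4, with equality exactly for [Lambda1]
    ([corner_weight]).  The boundary values weigh at least [min_weight] by
    definition.  For the defects ([cost_bound]): a defect costs at least 1, and
    exactly 1 when one of its values is next to the centre; an edge joining a
    homogeneous value to a heterogeneous one carries exactly one defect; and the
    cells with homogeneous values form half of the grid, so they are separated
    from the others by at least n1 edges ([grid_bisection]), with equality only
    for a straight cut.  The equality cases put together are the definition of
    [optimal_family], which gives [f_bound].

    It remains to reach the three bounds simultaneously.  Reflect everything to
    one quadrant: cells are coded by a half of the grid, a colour of the
    checkerboard and a point of a t1 x t2 rectangle, values by a quadrant and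
    the offset from the centre.  An arrangement is then given by two bijections
    of the rectangle, one for the left and one for the right half, which send
    the frame (the border cells) to the t1 + t2 - 1 points closest to the
    centre, and such that in each row at least one of the two cells next to the
    cutting line gets an offset in row 0.  The frame cell next to the line can get
    the offset (0, 1); of the t1 - 1 other rows each bijection handles t1./2,
    using the last t1./2 points of row 0.  These must lie outside the
    ball of the frame, which is a matter of counting points of a triangle
    ([triangle_card]); this count is where the squares of side 4, 8, 12 and 16
    fail. *)

(** * Bijections and sets prescribed by counting *)

Section Fibers.
Variable T : finType.

(** Match the two fibers over each key in the order of their enumerations. *)
Lemma perm_of_fibers (K : eqType) (F G : T -> K) :
  (forall k, #|[set x | F x == k]| = #|[set x | G x == k]|) ->
  exists s : {perm T}, forall x, G (s x) = F x.
Proof.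
move=> FG.
pose EF k := enum [set x | F x == k]; pose EG k := enum [set x | G x == k].
pose g x := nth x (EG (F x)) (index x (EF (F x))).
have lt_g x : (index x (EF (F x)) < size (EG (F x)))%N.
  by rewrite -cardE -FG cardE index_mem mem_enum inE.
have Gg x : G (g x) = F x.
  by have := mem_nth x (lt_g x); rewrite mem_enum inE => /eqP.
have g_inj : injective g.
  move=> x y eq_g; have eqF : F x = F y by rewrite -Gg eq_g Gg.
  have lt_y := lt_g y; move: eq_g; rewrite /g -eqF in lt_y *.
  rewrite (set_nth_default y) // => /eqP.
  rewrite nth_uniq ?lt_g ?enum_uniq // => /eqP eq_i.
  have mx z : F z = F x -> z \in EF (F x) by rewrite mem_enum inE => ->.
  by rewrite -(nth_index x (mx x erefl)) eq_i nth_index // mx.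
by exists (perm g_inj) => x; rewrite permE Gg.
Qed.

(** The form in which [perm_of_fibers] is used on a quadrant: [x0] is the corner,
    [x1] the frame cell next to the cutting line, [X] the frame and [A] the
    cells that have to receive a value of [Z]. *)
Lemma perm_flag (x0 x1 y0 y1 : T) (X Y A Z : {set T}) :
    x1 != x0 -> y1 != y0 -> x0 \in X -> x1 \in X -> y0 \in Y -> y1 \in Y ->
    #|X| = #|Y| -> #|A| = #|Z| -> [disjoint A & X] -> [disjoint Z & Y] ->
  exists s : {perm T}, [/\ s x0 = y0, s x1 = y1,
    forall x, (s x \in Y) = (x \in X) & forall x, x \in A -> s x \in Z].
Proof.
move=> x10 y10 Xx0 Xx1 Yy0 Yy1 cXY cAZ dAX dZY.
(* The conditions say that s preserves this partition into five classes. *)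
pose key (z0 z1 : T) (U V : {set T}) z : nat :=
  if z == z0 then 0 else if z == z1 then 1 else
  if z \in U then 2 else if z \in V then 3 else 4.
have fib z0 z1 (U V : {set T}) : z1 != z0 -> z0 \in U -> z1 \in U -> [disjoint V & U] ->
    forall k, [set z | key z0 z1 U V z == k] =
      nth set0 [:: [set z0]; [set z1]; U :\: [set z0; z1]; V; ~: (U :|: V)] k.
  move=> z10 Uz0 Uz1 dVU k; apply/setP=> z; rewrite inE /key.
  have i0 : z == z0 -> z \in U by move/eqP->.
  have i1 : z == z1 -> z \in U by move/eqP->.
  have i2 : z == z0 -> z != z1 by move/eqP->; rewrite eq_sym.
  have i3 : z \in V -> z \notin U by move=> Vz; rewrite (disjointFr dVU).
  case: k => [|[|[|[|[|k]]]]]; rewrite /= ?nth_nil; try rewrite !inE;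
  case: (z == z0) (z == z1) (z \in U) (z \in V) i0 i1 i2 i3
    => [] [] [] [] // i0 i1 i2 i3;
  first [by have := i0 isT | by have := i1 isT | by have := i2 isT | by have := i3 isT].
have [|s Hs] := @perm_of_fibers nat (key x0 x1 X A) (key y0 y1 Y Z).
  move=> k; rewrite !fib //.
  have U2 z0 z1 (U : {set T}) : z1 != z0 -> z0 \in U -> z1 \in U ->
      #|U :\: [set z0; z1]| = (#|U| - 2)%N.
    move=> z10 U0 U1; rewrite cardsD (setIidPr _) ?cards2 1?eq_sym ?z10 //.
    by apply/subsetP => z; rewrite !inE => /orP[] /eqP ->.
  case: k => [|[|[|[|[|k]]]]] //=; rewrite ?cards1 ?U2 ?cXY ?nth_nil //.
  by apply/eqP; rewrite -(eqn_add2l #|X :|: A|) cardsC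
     -(_ : #|Y :|: Z| = #|X :|: A|) ?cardsC // !cardsU cXY cAZ
     !(disjoint_setI0 (_ : [disjoint _ & _])) // 1?disjoint_sym.
have key0 z0 z1 (U V : {set T}) z : (key z0 z1 U V z == 0)%N = (z == z0).
  by rewrite /key; do !case: ifP.
have key1 z0 z1 (U V : {set T}) z : z1 != z0 -> (key z0 z1 U V z == 1)%N = (z == z1).
  by rewrite /key; case: (z =P z0) => [->|_]; [rewrite eq_sym => /negbTE-> | do !case: ifP].
have key2 z0 z1 (U V : {set T}) z : z0 \in U -> z1 \in U ->
    (key z0 z1 U V z <= 2)%N = (z \in U).
  by rewrite /key => U0 U1; case: eqP => [->|_]; [|case: eqP => [->|_]]; do ?case: ifP.
exists s; split.
- by apply/eqP; rewrite -(key0 _ y1 Y Z) Hs key0.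
- by apply/eqP; rewrite -(key1 y0 _ Y Z) // Hs key1.
- by move=> x; rewrite -(key2 y0 y1 _ Z) // Hs key2.
move=> x Ax; have: key y0 y1 Y Z (s x) = 3%N.
  rewrite Hs; apply/eqP; have := fib x0 x1 X A x10 Xx0 Xx1 dAX 3%N.
  by move/setP/(_ x); rewrite inE => ->.
move/eqP; have := fib y0 y1 Y Z y10 Yy0 Yy1 dZY 3%N.
by move/setP/(_ (s x)); rewrite inE => ->.
Qed.

(** Grow the set by adding each time an element of least key among those left. *)
Lemma exists_lower_set (key : T -> nat) k : (k <= #|T|)%N ->
  exists2 B : {set T}, #|B| = k &
    forall p q, p \in B -> q \notin B -> (key p <= key q)%N.
Proof.
elim: k => [_|k IHk lt_kT].
  by exists set0; [exact: cards0 | move=> p q; rewrite inE].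
have [B cB Blow] := IHk (ltnW lt_kT).
have : (0 < #|~: B|)%N by have := cardsC B; lia.
case/card_gt0P => x0 Bx0.
case: (arg_minnP key Bx0) => x Bx xmin.
have {}Bx : x \notin B by rewrite -in_setC; exact: Bx.
exists (x |: B); first by rewrite cardsU1 cB Bx.
move=> p q; rewrite !inE negb_or => /predU1P[->|Bp] /andP[_ Bq].
  by apply: xmin; rewrite [_ q]in_setC.
exact: Blow.
Qed.

(** Exchange argument: the elements of [A :\: A'] and of [A' :\: A] are equally
    many, and each of the former is at most each of the latter. *)
Lemma lower_set_min (R : realFieldType) (d : T -> R) (A A' : {set T}) :
    (forall x y, x \in A -> y \notin A -> (d x <= d y)%R) -> #|A'| = #|A| ->
  (\sum_(x in A) d x <= \sum_(x in A') d x)%R.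
Proof.
move=> Alow cA.
rewrite (big_setID A') [leRHS](big_setID A) /= setIC lerD2l.
have cD : #|A :\: A'| = #|A' :\: A|.
  by apply/eqP; rewrite -(eqn_add2l #|A :&: A'|) cardsID setIC cardsID cA.
have [c0|c_gt0] := posnP #|A :\: A'|.
  by rewrite (cards0_eq c0) (cards0_eq (etrans (esym cD) c0)).
(* Compare both sums, multiplied by the common cardinal, term by term over the
   pairs of (A minus A') x (A' minus A). *)
have sumC (X Y : {set T}) : ((\sum_(x in X) d x) *+ #|Y| = \sum_(x in X) \sum_(y in Y) d x)%R.
  by rewrite -sumrMnl; apply: eq_bigr => x _; rewrite sumr_const.
rewrite -(ler_pMn2r c_gt0) [in leLHS]cD !sumC [leRHS]exchange_big /=.
apply: ler_sum => x; rewrite inE => /andP[xA' xA].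
by apply: ler_sum => y; rewrite inE => /andP[yA yA']; exact: Alow.
Qed.
End Fibers.

(** * Bisections of a rectangular grid *)

Definition changes (a : nat -> bool) (n : nat) : nat :=
  \sum_(j < n.-1) (a j != a j.+1).

Lemma changes0 a n : changes a n = 0 -> forall j, j < n -> a j = a 0.
Proof.
move=> /eqP; rewrite sum_nat_eq0 => /forallP a0; elim=> // j IHj lt_jn.
have lt_j1 : j < n.-1 by lia.
by have := a0 (Ordinal lt_j1); rewrite /= eqb0 negbK => /eqP <-; apply: IHj; lia.
Qed.

Lemma changes1 a n : changes a n = 1 ->
  exists2 c, c <= n & forall j, j < n -> a j = a 0 (+) (c <= j).
Proof.
elim: n => [|n IHn]; first by rewrite /changes big_ord0.
case: n IHn => [|n] IHn; first by rewrite /changes big_ord0.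
rewrite /changes big_ord_recr /= -[X in X + _]/(changes a n.+1).
case: eqP => [eq_a|/eqP neq_a].
  rewrite addn0 => /IHn[c le_c ac].
  have le_cn : a n.+1 = a 0 (+) (c <= n) by rewrite -eq_a ac.
  have [le_c_n|lt_n_c] := leqP c n.
    exists c => [|j lt_j]; first lia.
    move: lt_j; rewrite ltnS leq_eqVlt => /predU1P[->|]; last exact: ac.
    by rewrite le_cn; congr (_ (+) _); lia.
  have c_eq : c = n.+1 by lia.
  exists n.+2 => // j; rewrite ltnS leq_eqVlt => /predU1P[->|lt_j].
    by rewrite le_cn; congr (_ (+) _); lia.
  by rewrite ac //; congr (_ (+) _); lia.
rewrite addn1 => -[] /changes0 ac; exists n.+1 => // j.
rewrite ltnS leq_eqVlt => /predU1P[->|lt_j].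
  by move: neq_a; rewrite leqnn addbT ac //; case: (a n.+1) (a 0) => [] [].
by rewrite ac // leqNgt lt_j addbF.
Qed.

Definition hcut (g : nat -> nat -> bool) (n1 n2 : nat) : nat :=
  \sum_(i < n1) changes (g i) n2.

Definition volume (g : nat -> nat -> bool) (n1 n2 : nat) : nat :=
  \sum_(i < n1) \sum_(j < n2) g i j.

Definition transp (g : nat -> nat -> bool) i j := g j i.

Lemma volume_transp g n1 n2 : volume (transp g) n2 n1 = volume g n1 n2.
Proof. exact: exchange_big. Qed.

Lemma mixed_changes (a : nat -> bool) n j k :
  j < n -> k < n -> a j != a k -> 0 < changes a n.
Proof.
move=> lt_j lt_k; apply: contraR; rewrite -eqn0Ngt => /eqP /changes0 ac.
by rewrite !ac.
Qed.

(** A set meeting and missing every row is cut at least once in each row.  If there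
    are no further cuts, then all rows are equal, so each is a threshold, and the
    volume places the threshold in the middle. *)
Lemma mixed_rows_cut g n1 n2 : 0 < n1 ->
    (volume g n1 n2).*2 = n1 * n2 ->
    (forall i, i < n1 -> 0 < changes (g i) n2) ->
  n1 <= hcut g n1 n2 /\
  (hcut g n1 n2 + hcut (transp g) n2 n1 <= n1 -> forall i j, i < n1 -> j < n2 ->
     g i j = g 0 0 (+) (n2./2 <= j)).
Proof.
move=> n1_gt0 gvol gmix.
have le_cut : n1 <= hcut g n1 n2.
  rewrite -[leqLHS]card_ord -sum1_card; apply: leq_sum => i _; exact: gmix.
split=> // cut_le.
have vcut0 : hcut (transp g) n2 n1 = 0 by lia.
have g_row i j : i < n1 -> j < n2 -> g i j = g 0 j.
  move=> lt_i lt_j; move/eqP: vcut0; rewrite sum_nat_eq0.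
  by move=> /forallP/(_ (Ordinal lt_j))/= /eqP /changes0 /(_ i lt_i).
have hcutE : hcut g n1 n2 = n1 * changes (g 0) n2.
  rewrite /hcut -[in RHS](card_ord n1) -sum_nat_const; apply: eq_bigr => i _.
  apply: eq_bigr => j _; have lt_j := ltn_ord j.
  by rewrite (g_row i j) ?(g_row i j.+1) //; lia.
have /changes1[c le_c gc] : changes (g 0) n2 = 1.
  by apply/eqP; rewrite -(eqn_pmul2l n1_gt0) muln1; lia.
have volE : volume g n1 n2 = n1 * \sum_(j < n2) (g 0 0 (+) (c <= j)).
  rewrite /volume -[in RHS](card_ord n1) -sum_nat_const; apply: eq_bigr => i _.
  by apply: eq_bigr => j _; rewrite g_row // gc.
have cardE : \sum_(j < n2) (g 0 0 (+) (c <= j)) = if g 0 0 then c else n2 - c.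
  rewrite -(big_mkord xpredT (fun j => (g 0 0 (+) (c <= j)) : nat)).
  rewrite (@big_cat_nat _ _ _ c) //=.
  rewrite (@eq_big_nat _ _ _ 0 c _ (fun=> (g 0 0 : nat))); last first.
    by move=> j /andP[_ lt_j]; rewrite leqNgt lt_j addbF.
  rewrite (@eq_big_nat _ _ _ c n2 _ (fun=> (~~ g 0 0 : nat))); last first.
    by move=> j /andP[-> _]; rewrite addbT.
  by rewrite !sum_nat_const_nat; case: (g 0 0); lia.
have n2E : (if g 0 0 then c else n2 - c).*2 = n2.
  apply/eqP; rewrite -(eqn_pmul2l n1_gt0) -gvol volE cardE.
  by rewrite -!muln2 mulnA.
have c_half : c = n2./2 by move: n2E; case: (g 0 0); lia.
by move=> i j lt_i lt_j; rewrite g_row // gc // c_half.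
Qed.

(** If some row and some column are constant, they meet, so they have the same
    value [b].  Every row or column containing a point of the other value is then
    cut.  With R such rows and C such columns the volume is at most R C; if R + C
    were at most n1, this would be at most n1 ^ 2 / 4, less than half of the
    grid. *)
Lemma grid_bisection g n1 n2 :
    0 < n1 -> n1 <= n2 -> (volume g n1 n2).*2 = n1 * n2 ->
  n1 <= hcut g n1 n2 + hcut (transp g) n2 n1 /\
  (hcut g n1 n2 + hcut (transp g) n2 n1 = n1 ->
   (forall i j, i < n1 -> j < n2 -> g i j = g 0 0 (+) (n2./2 <= j)) \/
   n1 = n2 /\
   (forall i j, i < n1 -> j < n2 -> g i j = g 0 0 (+) (n1./2 <= i))).
Proof.
move=> n1_gt0 le_n gvol.
have [/forallP rmix|] := boolP [forall i : 'I_n1, 0 < changes (g i) n2].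
  have [i lt_i|le_cut shape] := mixed_rows_cut n1_gt0 gvol.
    exact: rmix (Ordinal lt_i).
  by split=> [|eq_cut]; [lia | left; apply: shape; lia].
rewrite negb_forall => /existsP[i0]; rewrite -eqn0Ngt => /eqP /changes0 row0.
have [/forallP cmix|] := boolP [forall j : 'I_n2, 0 < changes (transp g j) n1].
  have [||j lt_j|le_cut shape] := @mixed_rows_cut (transp g) n2 n1.
  - lia.
  - by rewrite volume_transp gvol mulnC.
  - exact: cmix (Ordinal lt_j).
  split=> [|eq_cut]; first by lia.
  have eq_n : n1 = n2 by lia.
  right; split=> // i j lt_i lt_j; apply: (shape _ j i) => //.
  by rewrite addnC -[transp (transp g)]/g; lia.
rewrite negb_forall => /existsP[j0]; rewrite -eqn0Ngt => /eqP /changes0 col0.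
pose b := g i0 j0.
have row_b j : j < n2 -> g i0 j = b by move=> lt_j; rewrite /b !row0.
have col_b i : i < n1 -> g i j0 = b.
  by move=> lt_i; have := col0 i lt_i; rewrite /b /transp => ->; have := col0 i0 (ltn_ord _).
pose rho i := has (fun j => g i j != b) (iota 0 n2).
pose kap j := has (fun i => g i j != b) (iota 0 n1).
have rho_cut : \sum_(i < n1) rho i <= hcut g n1 n2.
  apply: leq_sum => i _; rewrite /rho; case: hasP => [[j]|//]; rewrite mem_iota => lt_j neq.
  by apply: (@mixed_changes _ _ j j0); rewrite ?col_b.
have kap_cut : \sum_(j < n2) kap j <= hcut (transp g) n2 n1.
  apply: leq_sum => j _; rewrite /kap; case: hasP => [[i]|//]; rewrite mem_iota => lt_i neq.
  by apply: (@mixed_changes _ _ i i0); rewrite // /transp row_b.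
have vol_b : (\sum_(i < n1) \sum_(j < n2) (g i j != b)).*2 = n1 * n2.
  move: gvol; case: (b); last first.
    by move=> <-; congr double; apply: eq_bigr => i _; apply: eq_bigr => j _; case: (g i j).
  suff : volume g n1 n2 + \sum_(i < n1) \sum_(j < n2) (g i j != true) = n1 * n2 by lia.
  rewrite -big_split /= -[in RHS](card_ord n1) -sum_nat_const; apply: eq_bigr => i _.
  rewrite -big_split /= -[RHS](card_ord n2) -sum1_card; apply: eq_bigr => j _.
  by case: (g i j).
have vol_le : \sum_(i < n1) \sum_(j < n2) (g i j != b) <=
    (\sum_(i < n1) rho i) * (\sum_(j < n2) kap j).
  rewrite big_distrl; apply: leq_sum => i _; rewrite big_distrr; apply: leq_sum => j _.
  case: eqP => //= /eqP neq; rewrite muln_gt0 !lt0b /rho /kap.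
  by apply/andP; split; apply/hasP; [exists (j : nat) | exists (i : nat)];
    rewrite // mem_iota add0n ltn_ord.
suff : n1 < \sum_(i < n1) rho i + \sum_(j < n2) kap j by lia.
rewrite ltnNge; apply/negP => le_n1.
have le_sq : (\sum_(i < n1) rho i + \sum_(j < n2) kap j) ^ 2 <= n1 * n2.
  by apply: leq_mul => //; apply: leq_trans le_n.
have n_gt0 : 0 < n1 * n2 by rewrite muln_gt0 n1_gt0 (leq_trans n1_gt0).
by have := (nat_AGM2 (\sum_(i < n1) rho i) (\sum_(j < n2) kap j)).1; lia.
Qed.

(** * The objective as a sum over cells minus a defect cost *)

Definition cell m l (i j : nat) : grid m.+1 l.+1 := (inord i, inord j).

Lemma cellK m l (x : grid m.+1 l.+1) : cell m l x.1 x.2 = x.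
Proof. by case: x => i j; rewrite /cell /= !inord_val. Qed.

Lemma sum_grid m l (G : grid m.+1 l.+1 -> nat) :
  \sum_x G x = \sum_(i < m.+1) \sum_(j < l.+1) G (cell m l i j).
Proof.
rewrite pair_big /=; apply: eq_bigr => x _; congr G.
by rewrite -[LHS]cellK.
Qed.

Lemma edgesE n1 n2 (x y : grid n1 n2) : ((x, y) \in edges n1 n2) =
  (y.1 == x.1 :> nat) && (y.2 == x.2.+1 :> nat)
  || (y.1 == x.1.+1 :> nat) && (y.2 == x.2 :> nat).
Proof.
case: x y => [a b] [c d].
rewrite !inE /dist /pos /coord /= !norm_subn -!natrD.
by rewrite !(eqr_nat rat _ 1); lia.
Qed.

(** The sum over edges splits into horizontal and vertical edges, indexed by natural
    numbers so that [hcut] and the telescoping of [sum_path] apply. *)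
Lemma sum_edges m l (F : grid m.+1 l.+1 -> grid m.+1 l.+1 -> nat) :
  \sum_(e in edges m.+1 l.+1) F e.1 e.2 =
    \sum_(i < m.+1) \sum_(j < l) F (cell m l i j) (cell m l i j.+1) +
    \sum_(j < l.+1) \sum_(i < m) F (cell m l i j) (cell m l i.+1 j).
Proof.
have -> : \sum_(e in edges m.+1 l.+1) F e.1 e.2 =
    \sum_(x : grid m.+1 l.+1) ((if x.2 < l then F x (cell m l x.1 x.2.+1) else 0) +
            (if x.1 < m then F x (cell m l x.1.+1 x.2) else 0)).
  rewrite (eq_bigl (fun e => (e.1, e.2) \in edges m.+1 l.+1)); last by case.
  rewrite -(pair_big_dep xpredT (fun x y => (x, y) \in edges m.+1 l.+1) F) /=.
  apply: eq_bigr => x _; rewrite big_mkcond /=.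
  have lt1 := ltn_ord x.1; have lt2 := ltn_ord x.2.
  rewrite (eq_bigr (fun y : grid m.+1 l.+1 =>
      (if (y.1 == x.1 :> nat) && (y.2 == x.2.+1 :> nat) then F x y else 0) +
      (if (y.1 == x.1.+1 :> nat) && (y.2 == x.2 :> nat) then F x y else 0))).
    rewrite big_split /= -!big_mkcond /=; congr (_ + _).
      case: ifP => le_x.
        rewrite (big_pred1 (cell m l x.1 x.2.+1)) // => y.
        by rewrite /= -pair_eqE /= /pair_eq -!val_eqE /= !inordK.
      by rewrite big_pred0 // => y; have := ltn_ord y.2; lia.
    case: ifP => le_x.
      rewrite (big_pred1 (cell m l x.1.+1 x.2)) // => y.
      by rewrite /= -pair_eqE /= /pair_eq -!val_eqE /= !inordK.
    by rewrite big_pred0 // => y; have := ltn_ord y.1; lia.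
  move=> y _; rewrite edgesE.
  by case: ifP; do 2![case: ifP]; lia.
rewrite big_split /= !sum_grid [X in _ + X = _]exchange_big /=; congr (_ + _).
  apply: eq_bigr => i _; rewrite big_ord_recr /= (inordK (ltnSn l)) ltnn addn0.
  apply: eq_bigr => j _.
  have lt_j : j < l.+1 by rewrite ltnS ltnW ?ltn_ord.
  by rewrite (inordK lt_j) (inordK (ltn_ord i)) ltn_ord.
apply: eq_bigr => j _; rewrite big_ord_recr /= (inordK (ltnSn m)) ltnn addn0.
apply: eq_bigr => i _.
have lt_i : i < m.+1 by rewrite ltnS ltnW ?ltn_ord.
by rewrite (inordK lt_i) (inordK (ltn_ord j)) ltn_ord.
Qed.

(** Each vertex of a path has degree 2, except for the two ends. *)
Lemma sum_path (g : nat -> nat) l :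
  \sum_(j < l) (g j + g j.+1) + (g 0 + g l) = (\sum_(j < l.+1) g j).*2.
Proof.
elim: l => [|l IHl]; first by rewrite big_ord0 big_ord1 /= add0n addnn.
rewrite big_ord_recr /= [in RHS]big_ord_recr /= doubleD -IHl. by set S := \sum_(i < l) _; lia.
Qed.

Lemma sum_extremal n (g : nat -> nat) :
  \sum_(i < n.+2) ((i.+1 == 1) || (i.+1 == n.+2)) * g i = g 0 + g n.+1.
Proof.
rewrite big_ord_recl big_ord_recr /= eqxx mul1n big1 ?mul1n // => i _.
by rewrite /= /bump /= add1n; have := ltn_ord i; lia.
Qed.

Lemma sum_degree n1 n2 (G : grid n1 n2 -> nat) : 1 < n1 -> 1 < n2 ->
  \sum_(e in edges n1 n2) (G e.1 + G e.2) +
    \sum_x (extremal Row x + extremal Col x) * G x = 4 * \sum_x G x.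
Proof.
case: n1 G => [|[|m]] //; case: n2 => [|[|l]] // G _ _.
rewrite (sum_edges (fun x y => G x + G y)).
rewrite (eq_bigr (fun x => extremal Col x * G x + extremal Row x * G x)); last first.
  by move=> x _; rewrite -mulnDl addnC.
rewrite big_split /= addnACA.
have -> : 4 * \sum_x G x = (\sum_x G x).*2 + (\sum_x G x).*2 by lia.
congr (_ + _).
  rewrite !sum_grid -big_split /= -[in RHS]muln2 big_distrl /=.
  apply: eq_bigr => i _; rewrite muln2 -(sum_path (fun j => G (cell m.+1 l.+1 i j))); congr (_ + _).
  rewrite -(sum_extremal l (fun j => G (cell m.+1 l.+1 i j))).
  by apply: eq_bigr => j _; rewrite /extremal /= inordK.
rewrite !sum_grid [X in _ + X = _]exchange_big [in RHS]exchange_big /= -big_split /= -[in RHS]muln2 big_distrl /=.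
apply: eq_bigr => i _; rewrite muln2 -(sum_path (fun j => G (cell m.+1 l.+1 j i))); congr (_ + _).
rewrite -(sum_extremal m (fun j => G (cell m.+1 l.+1 j i))).
by apply: eq_bigr => j _; rewrite /extremal /= inordK.
Qed.

Section Values.
Variables n1 n2 : nat.
Implicit Types (x y : grid n1 n2) (i : axis) (s : {perm grid n1 n2}).

(** Twice the distance to the centre along the axis [i], which is a natural number;
    one of the two truncated differences vanishes. *)
Definition cdist i x : nat :=
  ((coord i x).*2 - (extent n1 n2 i).+1) + ((extent n1 n2 i).+1 - (coord i x).*2).

Definition cdist2 x := cdist Row x + cdist Col x.

Lemma dist_center x : (dist (pos x) (center n1 n2) = (cdist2 x)%:R / 2)%R.
Proof.
have half_dist (a n : nat) : (`|a%:R - (n%:R + 1) / 2| =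
    (a.*2 - n.+1 + (n.+1 - a.*2))%:R / 2 :> rat)%R.
  rewrite -norm_subn -[in RHS](@ger0_norm rat 2) // -normf_div; congr `|_|%R.
  by rewrite -muln2 natrM -(addn1 n) natrD; lra.
by rewrite /dist /pos /center /= !half_dist -mulrDl -natrD.
Qed.

Lemma weight_cdist (A : {set grid n1 n2}) :
  (weight A = (\sum_(x in A) cdist2 x)%:R / 2)%R.
Proof.
rewrite /weight natr_sum mulr_suml; apply: eq_bigr => x _; exact: dist_center.
Qed.

(** The loss in the triangle inequality through the centre is twice the smaller of
    the two distances, that is, the smaller [cdist]. *)
Definition defect_cost i x y : nat :=
  if small i x == small i y then minn (cdist i x) (cdist i y) else 0.

Definition edge_cost x y := defect_cost Row x y + defect_cost Col x y.

Definition cost s : nat := \sum_(e in edges n1 n2) edge_cost (s e.1) (s e.2).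

Definition distn x y : nat :=
  (x.1 - y.1) + (y.1 - x.1) + ((x.2 - y.2) + (y.2 - x.2)).

Lemma distnE x y : dist (pos x) (pos y) = ((distn x y)%:R)%R.
Proof. by rewrite /dist /pos /coord /= !norm_subn -natrD /distn !subSS. Qed.

Lemma distn_cost x y : ~~ odd n1 -> ~~ odd n2 ->
  (distn x y).*2 + (edge_cost x y).*2 = cdist2 x + cdist2 y.
Proof.
move=> ev1 ev2.
have axis_cost n a b : ~~ odd n ->
  let d c := (c.+1.*2 - n.+1) + (n.+1 - c.+1.*2) in
  ((a - b) + (b - a)).*2 +
    (if (a.+1 <= n./2) == (b.+1 <= n./2) then minn (d a) (d b) else 0).*2 = d a + d b.
  move=> ev d; rewrite /d; have {ev} -> : n = (n./2).*2 by lia.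
  rewrite doubleK; move: n./2 => t.
  by case: (leqP a.+1 t); case: (leqP b.+1 t) => /=; lia.
have := axis_cost n1 x.1 y.1 ev1; have := axis_cost n2 x.2 y.2 ev2.
rewrite /edge_cost /defect_cost /cdist2 /cdist /distn /small /coord /half /extent /=.
by rewrite !doubleD => E2 E1; rewrite addnACA E1 E2 addnACA.
Qed.

End Values.

(** The values come in pairs symmetric about the centre and run through the odd
    numbers, whose partial sums are squares. *)
Lemma sum_cdist_row n : ~~ odd n ->
  (\sum_(i < n) ((i.+1.*2 - n.+1) + (n.+1 - i.+1.*2))).*2 = n ^ 2.
Proof.
move=> ev; have {ev} -> : n = n./2 + n./2 by lia.
move: n./2 => t; rewrite big_split_ord /=.
have sum_odd : \sum_(i < t) (i.*2.+1) = t ^ 2.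
  elim: t => [|t IHt]; first by rewrite big_ord0.
  by rewrite big_ord_recr /= IHt; lia.
rewrite [X in X + _](reindex_inj rev_ord_inj) /=.
rewrite [X in X + _](eq_bigr (fun i : 'I_t => i.*2.+1)); last first.
  by move=> i _; have := ltn_ord i; lia.
rewrite [X in _ + X](eq_bigr (fun i : 'I_t => i.*2.+1)); last first.
  by move=> i _; have := ltn_ord i; lia.
by rewrite sum_odd; lia.
Qed.

Lemma sum_cdist2 n1 n2 : ~~ odd n1 -> ~~ odd n2 ->
  (\sum_(x : grid n1 n2) cdist2 x).*2 = n1 * n2 * (n1 + n2).
Proof.
move=> ev1 ev2.
rewrite -(pair_big xpredT xpredT (fun i j => cdist2 ((i, j) : grid n1 n2))) /=.
rewrite (eq_bigr (fun i : 'I_n1 => n2 * ((i.+1.*2 - n1.+1) + (n1.+1 - i.+1.*2)) +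
  \sum_(j < n2) ((j.+1.*2 - n2.+1) + (n2.+1 - j.+1.*2)))); last first.
  by move=> i _; rewrite /cdist2 /cdist big_split /= sum_nat_const card_ord.
rewrite big_split /= sum_nat_const card_ord -big_distrr /= doubleD.
by rewrite !doubleMr !sum_cdist_row //; lia.
Qed.

Section Formula.
Variables n1 n2 : nat.
Hypotheses (n1_gt1 : 1 < n1) (n2_gt1 : 1 < n2).
Hypotheses (n1_even : ~~ odd n1) (n2_even : ~~ odd n2).
Implicit Types (s : {perm grid n1 n2}).

Definition boundary_values s := border_values s :|: corner_values s.

Lemma boundary_valuesE s :
  boundary_values s = [set s x | x : grid n1 n2 & extremal Row x || extremal Col x].
Proof.
apply/setP=> y; rewrite /boundary_values /border_values !inE.
case: (boolP (y \in corner_values s)) => /=; last by rewrite orbF.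
  move=> /imsetP[x]; rewrite inE => /andP[xR xC] ->.
  by apply/esym/imset_f; rewrite inE xR.
Qed.

(** Counted once for each of the two border directions, corners count twice and the
    rest of the border once. *)
Lemma sum_boundary (G : grid n1 n2 -> nat) s :
  \sum_x (extremal Row x + extremal Col x) * G (s x) =
  \sum_(y in corner_values s) G y + \sum_(y in boundary_values s) G y.
Proof.
rewrite boundary_valuesE /corner_values !big_imset /=; try by move=> ? ? _ _; apply: perm_inj.
rewrite [X in _ = X + _]big_mkcond [X in _ = _ + X]big_mkcond -big_split /=.
by apply: eq_bigr => x _; rewrite !inE; do 2!case: extremal => /=; lia.
Qed.

(** The objective and the cost add up edge by edge to the distances of the values
    from the centre ([distn_cost]); in this sum a cell counts as often as its degree
    ([sum_degree]), that is, 4 minus the border corrections of [sum_boundary]. *)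
Lemma f_formula s :
  (f s = n1%:R * n2%:R * (n1%:R + n2%:R) - weight (corner_values s)
         - weight (boundary_values s) - (cost s)%:R)%R.
Proof.
have fE : f s = ((\sum_(e in edges n1 n2) distn (s e.1) (s e.2))%:R)%R.
  by rewrite natr_sum; apply: eq_bigr => e _; rewrite distnE.
have := sum_degree (fun x => cdist2 (s x)) n1_gt1 n2_gt1.
rewrite sum_boundary (_ : \sum_x cdist2 (s x) = \sum_(x : grid n1 n2) cdist2 x); last first.
  by rewrite [RHS](reindex_inj (@perm_inj _ s)).
rewrite (eq_bigr (fun e => (distn (s e.1) (s e.2)).*2 + (edge_cost (s e.1) (s e.2)).*2)); last first.
  by move=> e _; rewrite distn_cost.
rewrite big_split /= -!(big_morph _ doubleD double0) -/(cost s).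
have := sum_cdist2 n1_even n2_even => W E.
have : (\sum_(e in edges n1 n2) distn (s e.1) (s e.2)).*2 + (cost s).*2 +
   (\sum_(y in corner_values s) cdist2 y + \sum_(y in boundary_values s) cdist2 y)
   = (n1 * n2 * (n1 + n2)).*2 by rewrite E -W -!muln2 -mulnA mulnC.
rewrite fE !weight_cdist => /(congr1 (fun n : nat => n%:R%R : rat)).
by rewrite -!muln2 !(natrM, natrD); lra.
Qed.
End Formula.

(** * Lower bounds for the three losses *)

Lemma card_ord2 n a b : a < n -> b < n -> a != b ->
  #|[set i : 'I_n | (i == a :> nat) || (i == b :> nat)]| = 2.
Proof.
move=> lt_a lt_b neq_ab.
rewrite (_ : [set _ | _] = [set Ordinal lt_a; Ordinal lt_b]) ?cards2 ?neq_ab //.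
by apply/setP=> i; rewrite !inE.
Qed.

Section Bounds.
Variables n1 n2 : nat.
Hypotheses (n1_gt1 : 1 < n1) (n2_gt1 : 1 < n2).
Implicit Types (s : {perm grid n1 n2}).

Let rows := [set i : 'I_n1 | (i == 0 :> nat) || (i == n1.-1 :> nat)].
Let cols := [set j : 'I_n2 | (j == 0 :> nat) || (j == n2.-1 :> nat)].

Let card_rows : #|rows| = 2. Proof. by rewrite card_ord2; lia. Qed.
Let card_cols : #|cols| = 2. Proof. by rewrite card_ord2; lia. Qed.

Lemma card_corner_values s : #|corner_values s| = 4.
Proof.
rewrite card_imset; last exact: perm_inj.
rewrite -[RHS]/(2 * 2) -[X in X * _]card_rows -card_cols -cardsX.
by apply: eq_card => x; rewrite !inE /extremal /=; lia.
Qed.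

Lemma card_boundary_values s : #|boundary_values s| = 2 * n1 + 2 * n2 - 4.
Proof.
rewrite boundary_valuesE card_imset; last exact: perm_inj.
rewrite (_ : [set _ | _] = setX rows setT :|: setX setT cols); last first.
  by apply/setP => x; rewrite !inE /extremal /=; lia.
rewrite cardsU (_ : setX rows setT :&: setX setT cols = setX rows cols).
  by rewrite !cardsX !cardsT !card_ord card_rows card_cols; lia.
by apply/setP => x; rewrite !inE andbT.
Qed.

Lemma boundary_weight s :
  (min_weight n1 n2 (2 * n1 + 2 * n2 - 4) <= weight (boundary_values s))%R.
Proof.
have [|_ -> //] := @min_weightP n1 n2 (2 * n1 + 2 * n2 - 4); last exact: card_boundary_values.
by move: n1_gt1 n2_gt1; case: (n1) => [|[|p]] //; case: (n2) => [|[|q]] // _ _; lia.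
Qed.

End Bounds.

Section Values.
Variables n1 n2 : nat.
Implicit Types (s : {perm grid n1 n2}).

Lemma Lambda1E : Lambda1 n1 n2 = [set x | cdist2 x == 2].
Proof.
apply/setP => x; rewrite !inE dist_center -(eqr_nat rat).
by apply/eqP/eqP; lra.
Qed.

(** On the axis [i] the pair is no defect, or a defect of the least possible cost. *)
Definition central_defect i (x y : grid n1 n2) : bool :=
  (small i x == small i y) ==> (minn (cdist i x) (cdist i y) == 1).

(** The number of defects of a pair of values. *)
Definition monochromatic (x y : grid n1 n2) : nat :=
  (small Row x == small Row y) + (small Col x == small Col y).

Definition cut s : nat :=
  \sum_(e in edges n1 n2) (homogeneous (s e.1) != homogeneous (s e.2)).

(** Changing between homogeneous and heterogeneous means changing side on exactly
    one axis, so there is a defect on the other one; otherwise the number of defects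
    is 0 or 2. *)
Lemma cut_le_monochromatic x y :
  (homogeneous x != homogeneous y) <= monochromatic x y
    ?= iff ((homogeneous x == homogeneous y) ==> (monochromatic x y == 0)).
Proof.
rewrite /monochromatic /homogeneous.
by split; case: (small Row x) (small Row y) (small Col x) (small Col y) => [] [] [] [].
Qed.

Hypotheses (n1_even : ~~ odd n1) (n2_even : ~~ odd n2).

Lemma cdist_gt0 i (x : grid n1 n2) : 0 < cdist i x.
Proof. by rewrite /cdist; case: i => /=; lia. Qed.

Lemma card_Lambda1 : 1 < n1 -> 1 < n2 -> #|Lambda1 n1 n2| = 4.
Proof.
move=> n1_gt1 n2_gt1; rewrite Lambda1E -[RHS]/(2 * 2).
have c1 : #|[set i : 'I_n1 | (i == n1./2.-1 :> nat) || (i == n1./2 :> nat)]| = 2.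
  by rewrite card_ord2; lia.
have c2 : #|[set i : 'I_n2 | (i == n2./2.-1 :> nat) || (i == n2./2 :> nat)]| = 2.
  by rewrite card_ord2; lia.
rewrite -[X in _ = X * _]c1 -[X in _ = _ * X]c2 -cardsX; apply: eq_card => x.
rewrite !inE /cdist2 /cdist /=. lia.
Qed.

(** Four values of distance at least 1 from the centre; [Lambda1] has just four
    points. *)
Lemma corner_weight s : 1 < n1 -> 1 < n2 -> (4 <= weight (corner_values s))%R /\
  (weight (corner_values s) = 4%R <-> corner_values s = Lambda1 n1 n2).
Proof.
move=> n1_gt1 n2_gt1; have := @leqif_sum _ (fun x => x \in corner_values s) (fun x => cdist2 x == 2)
  (fun=> 2) (@cdist2 n1 n2).
case=> [x _|le_w eq_w].
  split; last by rewrite eq_sym.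
  by rewrite /cdist2; have := cdist_gt0 Row x; have := cdist_gt0 Col x; lia.
rewrite sum_nat_const card_corner_values // in le_w eq_w.
rewrite weight_cdist; split.
  by move: le_w; rewrite -(ler_nat rat); lra.
split=> [w4|CL].
  apply/eqP; rewrite eqEcard card_corner_values // card_Lambda1 // leqnn andbT.
  have: 4 * 2 == \sum_(i in corner_values s) cdist2 i.
    by rewrite -(eqr_nat rat); apply/eqP; lra.
  rewrite eq_w => /forall_inP C2; apply/subsetP => x /C2.
  by rewrite Lambda1E inE.
have/eqP <- : 4 * 2 == \sum_(i in corner_values s) cdist2 i.
  by rewrite eq_w; apply/forall_inP => x; rewrite CL Lambda1E inE.
by lra.
Qed.

Lemma monochromatic_le_cost x y :
  monochromatic x y <= edge_cost x y ?= iff central_defect Row x y && central_defect Col x y.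
Proof.
rewrite /monochromatic /edge_cost /defect_cost /central_defect.
have := cdist_gt0 Row x; have := cdist_gt0 Row y.
have := cdist_gt0 Col x; have := cdist_gt0 Col y.
by move=> ? ? ? ?; split; case: ifP => _; case: ifP => _ /=; lia.
Qed.

Lemma defectsP s :
  (forall i u, (u \in defects_large s i -> u = (half n1 n2 i).+1) /\
               (u \in defects_small s i -> u = half n1 n2 i)) <->
  (forall e, e \in edges n1 n2 -> forall i, central_defect i (s e.1) (s e.2)).
Proof.
have centralE i x y : central_defect i x y =
    (small i x && small i y ==> (maxn (coord i x) (coord i y) == half n1 n2 i))
    && (~~ small i x && ~~ small i y ==>
      (minn (coord i x) (coord i y) == (half n1 n2 i).+1)).
  by rewrite /central_defect /small /cdist /half; case: i => /=; lia.
split=> [D e Ee i | D i u].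
  rewrite centralE; apply/andP; split; apply/implyP => sm; apply/eqP.
    by apply: (D i _).2; apply: map_f; rewrite mem_filter sm mem_enum.
  by apply: (D i _).1; apply: map_f; rewrite mem_filter sm mem_enum.
split=> /mapP[e]; rewrite mem_filter mem_enum => /andP[sm Ee] ->;
  move: (D e Ee i); rewrite centralE => /andP[cs cl].
  exact/eqP/(implyP cl).
exact/eqP/(implyP cs).
Qed.

Lemma sum_homogeneous : (\sum_(x : grid n1 n2) homogeneous x).*2 = n1 * n2.
Proof.
have count_small n : ~~ odd n -> \sum_(i < n) (i < n./2) = n./2.
  move=> ev; rewrite -(big_mkord xpredT (fun i => (i < n./2) : nat)).
  rewrite (@big_cat_nat _ _ _ n./2) //=; last by lia.
  rewrite [X in X + _](@eq_big_nat _ _ _ 0 n./2 _ (fun=> 1)); last by move=> i; lia.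
  rewrite [X in _ + X](@eq_big_nat _ _ _ n./2 n _ (fun=> 0)); last by move=> i; lia.
  by rewrite !sum_nat_const_nat; lia.
rewrite -(pair_big xpredT xpredT (fun i j => homogeneous ((i, j) : grid n1 n2) : nat)) /=.
rewrite (eq_bigr (fun=> n2./2)); first by rewrite sum_nat_const card_ord doubleMr; congr (_ * _); lia.
move=> i _; rewrite /homogeneous /small /half /=.
case: (i < n1./2).
  by rewrite -[RHS]count_small //; apply: eq_bigr => j _; case: (_ < _).
have : \sum_(j < n2) (j < n2./2) + \sum_(j < n2) (false == (j < n2./2)) = n2.
  rewrite -big_split /= -[RHS]card_ord -sum1_card; apply: eq_bigr => j _.
  by case: (_ < _).
by rewrite count_small // => E; apply/eqP; rewrite -(eqn_add2l n2./2) E; lia.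
Qed.

End Values.

(** The part of [split_along] that speaks of the positions of the homogeneous values
    alone. *)
Definition straight n1 n2 (s : {perm grid n1 n2}) (a : axis) : Prop :=
  exists2 H : {set grid n1 n2},
    H = [set x | small a x] \/ H = [set x | ~~ small a x] &
    forall x, (x \in H) = homogeneous (s x).

Lemma cut_hcut m l (s : {perm grid m.+1 l.+1}) :
  let g i j := homogeneous (s (cell m l i j)) in
  cut s = hcut g m.+1 l.+1 + hcut (transp g) l.+1 m.+1.
Proof. exact: (sum_edges (fun x y => (homogeneous (s x) != homogeneous (s y)) : nat)). Qed.

Lemma cut_bound n1 n2 (s : {perm grid n1 n2}) :
    0 < n1 -> n1 <= n2 -> ~~ odd n1 -> ~~ odd n2 ->
  n1 <= cut s /\ (cut s = n1 -> straight s Col \/ n1 = n2 /\ straight s Row).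
Proof.
case: n1 s => // m; case: n2 => // l s _ le_n ev1 ev2.
rewrite cut_hcut; set g := fun i j => _.
have gE x : homogeneous (s x) = g x.1 x.2 by rewrite /g cellK.
have gvol : (volume g m.+1 l.+1).*2 = m.+1 * l.+1.
  rewrite -(sum_homogeneous ev1 ev2) [in RHS](reindex_inj (@perm_inj _ s)) /= sum_grid.
  by rewrite /volume.
have [le_cut shape] := grid_bisection (isT : 0 < m.+1) le_n gvol.
split=> // /shape[gc|[eq_n gr]]; [left | right; split=> //].
  exists [set x | homogeneous (s x)] => [|x]; last by rewrite inE.
  case: (g 0 0) gc => gc; [left | right]; apply/setP => x;
    rewrite !inE gE gc ?ltn_ord // /small /half /=.
    by rewrite -ltnNge.
  by rewrite -leqNgt.
exists [set x | homogeneous (s x)] => [|x]; last by rewrite inE.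
case: (g 0 0) gr => gr; [left | right]; apply/setP => x;
  rewrite !inE gE gr ?ltn_ord // /small /half /=.
  by rewrite -ltnNge.
by rewrite -leqNgt.
Qed.

Lemma threshold_changes b t n : 0 < t < n -> changes (fun j => b (+) (j < t)) n = 1.
Proof.
case/andP=> t_gt0 lt_tn; have lt_t : t.-1 < n.-1 by lia.
rewrite /changes (bigD1 (Ordinal lt_t)) //= big1 => [|j].
  by rewrite prednK // leqnn ltnn; case: b.
by rewrite -val_eqE /= => neq_j; case: b; lia.
Qed.

Lemma const_changes b n : changes (fun=> b) n = 0.
Proof. by rewrite /changes big1 // => j _; rewrite eqxx. Qed.

Lemma straight_cut n1 n2 (s : {perm grid n1 n2}) a :
  1 < n1 -> 1 < n2 -> straight s a -> cut s = if a is Col then n1 else n2.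
Proof.
case: n1 s => // m; case: n2 => // l s m_gt0 l_gt0 [H HE sH].
have [b {}HE] : exists b, forall x, (x \in H) = b (+) small a x.
  by case: HE => ->; [exists false | exists true] => x; rewrite inE.
rewrite cut_hcut /hcut.
case: a HE => HE.
  rewrite big1 => [|i _]; last first.
    rewrite -[RHS](const_changes (b (+) (i < m.+1./2)) l.+1); apply: eq_bigr => j _.
    by rewrite -!sH !HE /small /half /= inordK.
  rewrite add0n -[RHS]muln1 -[X in _ = X * _](card_ord l.+1) -sum_nat_const.
  apply: eq_bigr => j _; rewrite -(@threshold_changes b m.+1./2 m.+1); last by lia.
  apply: eq_bigr => i _; have lt_i : i < m := ltn_ord i.
  by rewrite /transp -!sH !HE /small /half /= !inordK // ltnW.
rewrite [X in _ + X]big1 => [|i _]; last first.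
  rewrite -[RHS](const_changes (b (+) (i < l.+1./2)) m.+1); apply: eq_bigr => j _.
  by rewrite /transp -!sH !HE /small /half /= inordK.
rewrite addn0 -[RHS]muln1 -[X in _ = X * _](card_ord m.+1) -sum_nat_const.
apply: eq_bigr => i _; rewrite -(@threshold_changes b l.+1./2 l.+1); last by lia.
apply: eq_bigr => j _; have lt_j : j < l := ltn_ord j.
by rewrite -!sH !HE /small /half /= !inordK // ltnW.
Qed.

Section Cost.
Variables n1 n2 : nat.
Hypotheses (n1_gt1 : 1 < n1) (n1_le_n2 : n1 <= n2).
Hypotheses (n1_even : ~~ odd n1) (n2_even : ~~ odd n2).
Implicit Types (s : {perm grid n1 n2}).

Lemma split_alongE s a : split_along s a <-> straight s a /\
  (forall e, e \in edges n1 n2 ->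
     homogeneous (s e.1) = homogeneous (s e.2) -> monochromatic (s e.1) (s e.2) = 0).
Proof.
split=> [[H [HE hom het nomono]]|[[H HE sH] nomono]].
  have sH x : (x \in H) = homogeneous (s x).
    by have [/hom-> //|/het/negbTE->] := boolP (x \in H).
  split=> [|e Ee]; first by exists H.
  rewrite -!sH => /(nomono e Ee) mono.
  by have := mono Row; have := mono Col; rewrite /monochromatic => /negbTE-> /negbTE->.
exists H; split=> // [x|x|e Ee]; rewrite ?sH // => /(nomono e Ee) /eqP.
by rewrite addn_eq0 !eqb0 => /andP[mR mC] [].
Qed.

(** Cost >= number of defects >= cut edges >= n1.  Equality in the three steps
    means respectively that all defects are central, that there is no defect away
    from the cut, and that the cut is straight. *)
Lemma cost_bound s : n1 <= cost s /\
  (cost s = n1 <-> (split_along s Col \/ n1 = n2 /\ split_along s Row) /\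
     (forall e, e \in edges n1 n2 -> forall i, central_defect i (s e.1) (s e.2))).
Proof.
have n1_gt0 : 0 < n1 by lia.
have [cut_ge cut_eq] := cut_bound s n1_gt0 n1_le_n2 n1_even n2_even.
have [le_cm eq_cm] := @leqif_sum _ (fun e => e \in edges n1 n2) _ _ _
  (fun e _ => cut_le_monochromatic (s e.1) (s e.2)).
have [le_mc eq_mc] := @leqif_sum _ (fun e => e \in edges n1 n2) _ _ _
  (fun e _ => monochromatic_le_cost n1_even n2_even (s e.1) (s e.2)).
rewrite -/(cut s) -/(cost s) in le_cm eq_cm le_mc eq_mc.
split; first exact: leq_trans cut_ge (leq_trans le_cm le_mc).
split=> [costE | [spl cen]].
  have /eqP E1 : cut s == n1 by lia.
  move: eq_cm; rewrite (_ : (_ == _) = true); last by lia.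
  move=> /esym/forall_inP nomono.
  move: eq_mc; rewrite (_ : (_ == _) = true); last by lia.
  move=> /esym/forall_inP cen.
  have nomono' e : e \in edges n1 n2 -> homogeneous (s e.1) = homogeneous (s e.2) ->
    monochromatic (s e.1) (s e.2) = 0.
    by move=> /nomono/implyP h eq_h; apply/eqP/h/eqP.
  split; last by move=> e /cen /andP[cR cC] [].
  by case: (cut_eq E1) => [st|[eq_n st]]; [left | right; split=> //]; apply/split_alongE.
have st : (straight s Col \/ n1 = n2 /\ straight s Row) /\
  (forall e, e \in edges n1 n2 ->
     homogeneous (s e.1) = homogeneous (s e.2) -> monochromatic (s e.1) (s e.2) = 0).
  by case: spl => [/split_alongE[]|[? /split_alongE[]]]; split; auto.
case: st => st nomono.
have cutE : cut s = n1.
  by case: st => [/straight_cut|[eq_n /straight_cut]] -> //; lia.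
rewrite -[RHS]cutE; apply/eqP; rewrite eqn_leq (leq_trans le_cm le_mc) andbT.
have /eqP -> : cut s == \sum_(e in edges n1 n2) monochromatic (s e.1) (s e.2).
  by rewrite eq_cm; apply/forall_inP => e Ee; apply/implyP => /eqP /(nomono e Ee)->.
rewrite eq_leq //; apply/esym/eqP; rewrite eq_mc.
by apply/forall_inP => e Ee; rewrite !cen.
Qed.

Definition max_value : rat := (n1%:R * n2%:R * (n1%:R + n2%:R) - 4 - n1%:R
  - min_weight n1 n2 (2 * n1 + 2 * n2 - 4))%R.

(** The three losses are bounded independently, so their sum is minimal exactly when
    each of them is. *)
Lemma f_bound s : (f s <= max_value)%R /\ (f s = max_value <-> optimal_family s).
Proof.
have n2_gt1 : 1 < n2 by lia.
have [le4 eq4] := corner_weight n1_even n2_even s n1_gt1 n2_gt1.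
have le_w := boundary_weight n1_gt1 n2_gt1 s.
have [le_c eq_c] := cost_bound s.
rewrite f_formula // /max_value.
have le_cR : (n1%:R <= (cost s)%:R :> rat)%R by rewrite ler_nat.
split; first by lra.
split=> [eqM | [CL spl def wB]].
  have eq_cost : cost s = n1.
    by apply/eqP; rewrite -(eqr_nat rat); apply/eqP; lra.
  have [spl cen] := eq_c.1 eq_cost.
  split=> //.
  - by apply/eq4; lra.
  - exact/defectsP.
  by rewrite -/(boundary_values s); lra.
have -> : cost s = n1 by apply/eq_c; split=> //; apply/defectsP.
by rewrite (eq4.2 CL) /boundary_values wB; lra.
Qed.
End Cost.

(** * Filling one quadrant *)

Lemma card_pairs t1 t2 (P : nat -> nat -> bool) :
  #|[set p : 'I_t1 * 'I_t2 | P p.1 p.2]| = \sum_(u < t1) \sum_(w < t2) P u w.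
Proof.
rewrite pair_bigA /= -sum1_card [LHS]big_mkcond /=; apply: eq_bigr => p _.
by rewrite inE; case: (P _ _).
Qed.

Lemma sum_interval n a b : a <= b <= n -> \sum_(i < n) (a <= i < b) = b - a.
Proof.
move=> /andP[le_ab le_bn]; rewrite -(big_mkord xpredT (fun i => (a <= i < b) : nat)).
rewrite (@big_cat_nat _ _ _ a) ?(leq_trans le_ab) //= (@big_cat_nat _ _ _ b a) //=.
rewrite [X in X + _](@eq_big_nat _ _ _ 0 a _ (fun=> 0)); last by move=> i; lia.
rewrite [X in _ + (X + _)](@eq_big_nat _ _ _ a b _ (fun=> 1)); last by move=> i ->.
rewrite [X in _ + (_ + X)](@eq_big_nat _ _ _ b n _ (fun=> 0)); last by move=> i; lia.
by rewrite !sum_nat_const_nat; lia.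
Qed.

Lemma sum_point n a : a < n -> \sum_(i < n) (i == a :> nat) = 1.
Proof.
move=> lt_an; rewrite -[RHS](subSnn a) -(@sum_interval n a a.+1); last by lia.
by apply: eq_bigr => i _; congr nat_of_bool; lia.
Qed.

Section Quadrant.
Variables t1 t2 : nat.
Hypotheses (t1_gt1 : 1 < t1) (t1_le_t2 : t1 <= t2).

Local Notation P := ('I_t1 * 'I_t2)%type.
(** The points [(0, w)] with [m <= w] are the last [t1./2] points of row 0. *)
Let m := t2 - t1./2.

(** The border cells of one colour in one half of the grid, in the coordinates of
    [base] below: the outer column, and in each other column one cell, which
    lies in the top or in the bottom row of the grid according to parity. *)
Definition frame (p : P) : bool :=
  (p.2 == 0 :> nat) || (p.1 == (if odd p.2 then t1.-1 else 0) :> nat).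

Lemma card_frame : #|[set p | frame p]| = t1 + t2 - 1.
Proof.
rewrite (card_pairs t1 t2 (fun u w => (w == 0) || (u == (if odd w then t1.-1 else 0)))).
rewrite exchange_big /=.
have : 0 < t2 by lia.
case: (t2) => // l _; rewrite big_ord_recl /= sum_nat_const card_ord muln1.
rewrite (eq_bigr (fun=> 1)); first by rewrite sum1_card card_ord; lia.
by move=> w _; rewrite sum_point //; case: ifP; lia.
Qed.

(** The ball [B] contains both [(0, 0)], for the corner, and [(0, 1)], for the frame
    cell at the cutting line; the rows from [b] to [b + t1./2 - 1] next to the
    cutting line receive the points of row 0 from column [m] on, which are outside
    of the ball. *)
Lemma quadrant_perm (B : {set P}) (b : nat) :
    [/\ #|B| = t1 + t2 - 1,
     forall p : P, p.1 = 0 :> nat -> p.2 <= 1 -> p \in B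
   & forall p : P, p \in B -> p.1 = 0 :> nat -> p.2 < m] ->
    b + t1./2 <= t1 ->
    ~~ (b <= (if odd t2.-1 then t1.-1 else 0) < b + t1./2) ->
  exists s : {perm P}, [/\
    forall p : P, p.1 = 0 :> nat -> p.2 = 0 :> nat -> (s p).1 = 0 :> nat /\ (s p).2 = 0 :> nat,
    forall p, (s p \in B) = frame p
  & forall p : P, p.2 = t2.-1 :> nat -> frame p || (b <= p.1 < b + t1./2) ->
      (s p).1 = 0 :> nat].
Proof.
move=> [cB B01 Bm] le_b e_out.
have lt01 : 0 < t1 by lia. have lt02 : 0 < t2 by lia. have lt12 : 1 < t2 by lia.
have lt_e : (if odd t2.-1 then t1.-1 else 0) < t1 by case: ifP; lia.
have lt_l : t2.-1 < t2 by lia.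
pose x0 : P := (Ordinal lt01, Ordinal lt02).
pose x1 : P := (Ordinal lt_e, Ordinal lt_l).
pose y1 : P := (Ordinal lt01, Ordinal lt12).
pose A := [set p : P | (b <= p.1 < b + t1./2) && (p.2 == t2.-1 :> nat)].
pose Z := [set p : P | (p.1 == 0 :> nat) && (m <= p.2 < t2)].
have cA : #|A| = t1./2.
  rewrite (card_pairs t1 t2 (fun u w => (b <= u < b + t1./2) && (w == t2.-1))).
  under eq_bigr => u _.
    under eq_bigr => w _ do rewrite -mulnb.
    rewrite -big_distrr /= sum_point // muln1.
    over.
  by rewrite sum_interval; lia.
have cZ : #|Z| = t1./2.
  rewrite (card_pairs t1 t2 (fun u w => (u == 0) && (m <= w < t2))).
  under eq_bigr => u _.
    under eq_bigr => w _ do rewrite -mulnb.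
    rewrite -big_distrr /= sum_interval; last by rewrite /m; lia.
    over.
  by rewrite -big_distrl /= sum_point // /m; lia.
have [||||||||||s [s0 s1 sB sA]] := @perm_flag P x0 x1 x0 y1 [set p | frame p] B A Z.
- by rewrite -pair_eqE /pair_eq -!val_eqE /=; lia.
- by rewrite -pair_eqE /pair_eq -!val_eqE /=; lia.
- by rewrite inE /frame.
- by rewrite inE /frame /= eqxx orbT.
- exact: B01.
- exact: B01.
- by rewrite card_frame cB.
- by rewrite cA cZ.
- rewrite disjoint_subset; apply/subsetP => p; rewrite !inE => /andP[Ap /eqP p2].
  rewrite /frame p2 negb_or; apply/andP; split; first by lia.
  by apply: contraNneq e_out => <-.
- rewrite disjoint_subset; apply/subsetP => p; rewrite !inE => /andP[/eqP p1 /andP[le_p _]].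
  by apply: contraTN le_p => /Bm-/(_ p1); rewrite ltnNge.
exists s; split=> [p p1 p2|p|p p2].
- suff -> : p = x0 by rewrite s0.
  by apply/eqP; rewrite -pair_eqE /pair_eq -!val_eqE /= p1 p2.
- by rewrite sB inE.
case/orP=> [|Ap]; last first.
  by have := sA p; rewrite !inE Ap p2 eqxx => /(_ isT) /andP[/eqP].
rewrite /frame p2 => /orP[|/eqP p1]; first by lia.
suff -> : p = x1 by rewrite s1.
by apply/eqP; rewrite -pair_eqE /pair_eq -!val_eqE /= p1 p2 !eqxx.
Qed.
Hypothesis t12 : t1 < t2 \/ t1 = t2 /\ t1 \notin [:: 2; 4; 6; 8].

(** The triangle contains m.+1, m, m - 1, ... points in its successive rows.  Since
    m is at least half of t1, six rows suffice for t1 >= 8; fewer rows exist, and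
    suffice, for the smaller t1, unless t1 = t2 is 2, 4, 6 or 8. *)
Lemma triangle_card : t1 + t2 <= #|[set p : P | p.1 + p.2 <= m]|.
Proof.
have m_lt : m < t2 by rewrite /m; lia.
rewrite (card_pairs t1 t2 (fun u w => u + w <= m)).
rewrite (eq_bigr (fun u : 'I_t1 => m.+1 - u)); last first.
  move=> u _; rewrite -[RHS]subn0 -(@sum_interval t2); last by lia.
  by apply: eq_bigr => w _; congr nat_of_bool; lia.
have sum_ge r : r <= t1 -> \sum_(u < r) (m.+1 - u) <= \sum_(u < t1) (m.+1 - u).
  move=> le_r; rewrite -!(big_mkord xpredT (fun u => m.+1 - u)).
  by rewrite [leqRHS](@big_cat_nat _ _ _ r) ?leq_addr.
move: t12; rewrite !inE => t12'.
have [t1_ge8 | t1_lt8] := leqP 8 t1.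
  apply: leq_trans (sum_ge 6 _); last by lia.
  by rewrite !big_ord_recr big_ord0 /= /m; lia.
have [t1_ge6 | t1_lt6] := leqP 6 t1.
  apply: leq_trans (sum_ge 5 _); last by lia.
  by rewrite !big_ord_recr big_ord0 /= /m; lia.
have [t1_ge4 | t1_lt4] := leqP 4 t1.
  apply: leq_trans (sum_ge 4 _); last by lia.
  by rewrite !big_ord_recr big_ord0 /= /m; lia.
have [t1_ge3 | t1_lt3] := leqP 3 t1.
  apply: leq_trans (sum_ge 3 _); last by lia.
  by rewrite !big_ord_recr big_ord0 /= /m; lia.
apply: leq_trans (sum_ge 2 _); last by lia.
by rewrite !big_ord_recr big_ord0 /= /m; lia.
Qed.

(** The ball is filled by increasing distance and, at equal distance, with the point
    of row 0 last.  So if it contained [(0, w)] with [m <= w], it would contain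
    the whole triangle of [triangle_card], which is too large. *)
Lemma exists_ball : exists B : {set P}, [/\ #|B| = t1 + t2 - 1,
   forall p q : P, p \in B -> q \notin B -> p.1 + p.2 <= q.1 + q.2,
   forall p : P, p.1 = 0 :> nat -> p.2 <= 1 -> p \in B
 & forall p : P, p \in B -> p.1 = 0 :> nat -> p.2 < m].
Proof.
(* Doubling the distance leaves room to put the point of row 0 last. *)
pose key (p : P) := (p.1 + p.2).*2 + (p.1 == 0 :> nat).
have [|B cB Blow] := @exists_lower_set P key (t1 + t2 - 1).
  by rewrite card_prod !card_ord; have := leq_mul t1_gt1 (leqnn t2); nia.
exists B; split=> // [p q Bp Bq|p p1 p2|p Bp p1].
- by have := Blow p q Bp Bq; rewrite /key; do 2!case: eqP; lia.
- apply: contraT => Bp.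
  have lt01 : 0 < t1 by lia. have lt02 : 0 < t2 by lia.
  have lt11 : 1 < t1 by lia. have lt12 : 1 < t2 by lia.
  pose S := [:: (Ordinal lt01, Ordinal lt02) : P;
    (Ordinal lt01, Ordinal lt12); (Ordinal lt11, Ordinal lt02)].
  have SP (q : P) : q.1 + q.2 <= 1 -> q \in S.
    by rewrite !inE -!pair_eqE /pair_eq -!val_eqE /=; lia.
  have : B \proper [set q in S].
    apply/properP; split; last by exists p; rewrite // inE SP //; lia.
    apply/subsetP => q Bq; rewrite inE SP //.
    by have := Blow q p Bq Bp; rewrite /key; do 2!case: eqP; lia.
  move/proper_card; rewrite cB cardsE => lt_S.
  by have := leq_trans lt_S (card_size S); rewrite /=; lia.
rewrite ltnNge; apply/negP => le_m.
have : #|[set q : P | q.1 + q.2 <= m]| <= #|B|.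
  apply/subset_leq_card/subsetP => q; rewrite inE => le_q.
  apply: contraT => Bq; have := Blow p q Bp Bq; rewrite /key p1 eqxx.
  case: eqP => q1; last by lia.
  have [neq|neq] := eqVneq q p; last first.
    by move: neq; rewrite -pair_eqE /pair_eq -!val_eqE /=; lia.
  by rewrite neq Bp in Bq.
by rewrite cB leqNgt; have := triangle_card; lia.
Qed.

End Quadrant.

(** Next to the cutting line there are t1 cells, one of which is in the frame and gets
    an offset in row 0 in any case.  The others form an interval of t1 - 1
    rows, covered by its first and its last t1./2 elements, one of these intervals
    for each of the two permutations. *)
Lemma quadrant_perms t1 t2 : 0 < t1 -> t1 <= t2 ->
  t1 < t2 \/ t1 = t2 /\ t1 \notin [:: 2; 4; 6; 8] ->
  exists (B : {set 'I_t1 * 'I_t2}) (s : bool -> {perm 'I_t1 * 'I_t2}), [/\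
    forall p q : 'I_t1 * 'I_t2, p \in B -> q \notin B -> p.1 + p.2 <= q.1 + q.2,
    forall v (p : 'I_t1 * 'I_t2), p.1 = 0 :> nat -> p.2 = 0 :> nat ->
      (s v p).1 = 0 :> nat /\ (s v p).2 = 0 :> nat,
    forall v p, (s v p \in B) = frame p
  & forall p : 'I_t1 * 'I_t2, p.2 = t2.-1 :> nat ->
      (s false p).1 = 0 :> nat \/ (s true p).1 = 0 :> nat].
Proof.
move=> t1_gt0 le_t t12.
have [t1_gt1|t1_le1] := ltnP 1 t1; last first.
  (* For t1 = 1 all cells are in the frame and all offsets are in row 0. *)
exists setT, (fun=> 1%g); split=> [p q _|v p|v p|p _]; rewrite ?inE ?perm1 //.
    have p1 : p.1 = 0 :> nat by have := ltn_ord p.1; lia.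
    have t1E : t1.-1 = 0 by lia.
    by rewrite /frame p1 t1E if_same orbT.
  by left; apply/eqP; rewrite -leqn0 -ltnS (leq_trans (ltn_ord p.1)).
have [B [cB Blow B01 Bm]] := exists_ball t1_gt1 le_t t12.
pose e := if odd t2.-1 then t1.-1 else 0.
(* e is the row of the frame cell; the other rows start at o. *)
pose o : nat := e == 0.
have [||s [s0 sB sl]] := quadrant_perm (b := o) t1_gt1 le_t (And3 cB B01 Bm).
- by rewrite /o; lia.
- by rewrite /o /e; case: ifP; lia.
have [||s' [s0' sB' sl']] := quadrant_perm (b := t1.-1 - t1./2 + o) t1_gt1 le_t (And3 cB B01 Bm).
- by rewrite /o; lia.
- by rewrite /o /e; case: ifP; lia.
exists B, (fun v : bool => if v then s' else s); split=> // [[]|[]|p p2] //.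
have [/(sl p p2)|] := boolP (frame p || (o <= p.1 < o + t1./2)); first by left.
rewrite negb_or => /andP[nf np]; right; apply: (sl' p p2); rewrite (negbTE nf) /=.
move: nf np; rewrite /frame p2 /o /e; have := ltn_ord p.1.
by case: ifP; lia.
Qed.

(** * An arrangement attaining the bound *)

Lemma fold_half_subproof t (i : 'I_t.*2) : (if t <= i then t.*2.-1 - i else i) < t.
Proof. by have := ltn_ord i; case: ifP; lia. Qed.

(** Reflects to the first half of the axis. *)
Definition fold_half t (i : 'I_t.*2) : 'I_t := Ordinal (fold_half_subproof i).

Lemma domino_subproof t (h : bool) (i : 'I_t.*2) :
  (if h then t.*2.-1 - i else i)./2 < t.
Proof. by have := ltn_ord i; case: ifP; lia. Qed.

(** Rows are grouped in pairs, since each colour has exactly one cell in the part of a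
    column in such a pair; [h] asks for a reflection of the rows first. *)
Definition domino t h (i : 'I_t.*2) : 'I_t := Ordinal (domino_subproof h i).

Lemma unfold_half_subproof t (b : bool) (u : 'I_t) :
  (if b then t + u else t.-1 - u) < t.*2.
Proof. by have := ltn_ord u; case: ifP; lia. Qed.

(** The value at offset [u] from the centre, on the side [b]. *)
Definition unfold_half t b (u : 'I_t) : 'I_t.*2 := Ordinal (unfold_half_subproof b u).

Lemma unfold_half_inj t b b' (u u' : 'I_t) :
  unfold_half b u = unfold_half b' u' -> b = b' /\ u = u'.
Proof.
move/(congr1 val) => /= E; have := ltn_ord u; have := ltn_ord u' => lt_u lt_u'.
have eq_b : b = b' by move: E; case: b; case: b'; lia.
by split=> //; apply: ord_inj; move: E; rewrite eq_b; case: ifP; lia.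
Qed.

Section Construction.
Variables t1 t2 : nat.
Variable s : bool -> {perm 'I_t1 * 'I_t2}.
Local Notation n1 := t1.*2.
Local Notation n2 := t2.*2.

Implicit Types x y : grid n1 n2.

Definition in_right_half x : bool := t2 <= x.2.
(** The colour in the checkerboard, made symmetric under reflection of the columns.
    Reflecting the rows exchanges the two colours, so after reflecting the flipped
    cells both classes have the same shape. *)
Definition flipped x : bool := odd x.1 (+) odd (fold_half x.2).
Definition base x : 'I_t1 * 'I_t2 := (domino (flipped x) x.1, fold_half x.2).

(** The colour decides on the side of the row value.  The column value is on
    the same side in the left half of the grid, making the value homogeneous, and on the
    opposite one in the right half. *)
Definition place x : grid n1 n2 :=
  let q := s (in_right_half x) (base x) in
  (unfold_half (flipped x) q.1, unfold_half (flipped x (+) in_right_half x) q.2).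

Lemma place_inj : injective place.
Proof.
move=> x y eq_xy; have [eq_f E1] := unfold_half_inj (congr1 fst eq_xy).
have [eq_fr E2] := unfold_half_inj (congr1 snd eq_xy).
have eq_r : in_right_half x = in_right_half y by move: eq_fr; rewrite eq_f => /addbI.
have : s (in_right_half x) (base x) = s (in_right_half x) (base y).
  by rewrite [RHS]surjective_pairing [LHS]surjective_pairing E1 E2 eq_r.
move/perm_inj => eq_base; have /= eq_d := congr1 (fun p => val p.1) eq_base.
have {eq_base} /= eq_c := congr1 (fun p => val p.2) eq_base.
have lx1 := ltn_ord x.1; have lx2 := ltn_ord x.2.
have ly1 := ltn_ord y.1; have ly2 := ltn_ord y.2.
have eq2 : x.2 = y.2 :> nat.
  by move: eq_r eq_c; rewrite /in_right_half => ->; case: ifP; lia.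
have eq1 : x.1 = y.1 :> nat.
  move: eq_f eq_d; rewrite /flipped /= eq2 => /addIb eq_o.
  by rewrite eq_o; case: ifP; lia.
by case: x y eq1 eq2 {eq_xy eq_f E1 eq_fr E2 eq_r eq_d eq_c lx1 lx2 ly1 ly2}
  => [a b] [c d] /= /ord_inj-> /ord_inj->.
Qed.

Definition arrangement : {perm grid n1 n2} := perm place_inj.

Lemma small_row_arrangement x : small Row (arrangement x) = ~~ flipped x.
Proof.
rewrite permE /small /half /= doubleK.
case: (s _ _) => u w /=; have := ltn_ord u.
by case: (flipped x) => /=; lia.
Qed.

Lemma small_col_arrangement x :
  small Col (arrangement x) = ~~ (flipped x (+) in_right_half x).
Proof.
rewrite permE /small /half /= doubleK.
case: (s _ _) => u w /=; have := ltn_ord w.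
by case: (flipped x (+) in_right_half x) => /=; lia.
Qed.

Lemma cdist_row_arrangement x :
  cdist Row (arrangement x) = (s (in_right_half x) (base x)).1.*2.+1.
Proof.
rewrite permE /cdist /=.
case: (s _ _) => u w /=; have := ltn_ord u.
by case: (flipped x) => /=; lia.
Qed.

Lemma cdist_col_arrangement x :
  cdist Col (arrangement x) = (s (in_right_half x) (base x)).2.*2.+1.
Proof.
rewrite permE /cdist /=.
case: (s _ _) => u w /=; have := ltn_ord w.
by case: (flipped x (+) in_right_half x) => /=; lia.
Qed.

Lemma frame_base x : frame (base x) = extremal Row x || extremal Col x.
Proof.
rewrite /frame /base /extremal /flipped /= orbC.
have := ltn_ord x.1; have := ltn_ord x.2 => l2 l1; congr orb; last by case: ifP; lia.
by case: (odd (if _ then _ else _)); case: ifP; lia.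
Qed.

Lemma base_corner x : extremal Row x -> extremal Col x ->
  (base x).1 = 0 :> nat /\ (base x).2 = 0 :> nat.
Proof.
rewrite /base /extremal /flipped /=.
have := ltn_ord x.1; have := ltn_ord x.2 => l2 l1 eR eC.
have -> : (if t2 <= x.2 then n2.-1 - x.2 else x.2) = 0 by case: ifP; lia.
by split=> //; rewrite addbF; case: ifP; lia.
Qed.

Lemma homogeneous_arrangement x : homogeneous (arrangement x) = ~~ in_right_half x.
Proof.
rewrite /homogeneous small_row_arrangement small_col_arrangement.
by case: (flipped x) (in_right_half x) => [] [].
Qed.

(** Inside a half, adjacent cells have different colours, so both coordinates change
    side.  Across the cutting line the two cells are mirror images and use the same
    point of the rectangle, so they make a defect of rows. *)
Lemma edge_arrangement x y : (x, y) \in edges n1 n2 ->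
  if in_right_half x == in_right_half y then flipped y = ~~ flipped x
  else base y = base x /\ flipped y = flipped x /\ (base x).2 = t2.-1 :> nat.
Proof.
rewrite edgesE /in_right_half => xy.
have lx1 := ltn_ord x.1; have lx2 := ltn_ord x.2.
have ly1 := ltn_ord y.1; have ly2 := ltn_ord y.2.
case: ifP => eq_r; first by rewrite /flipped /= -(eqP eq_r); case: ifP; lia.
have [e1 [e2 e3]] : x.1 = y.1 :> nat /\ x.2 = t2.-1 :> nat /\ y.2 = t2 :> nat by lia.
have eq_fold : fold_half x.2 = fold_half y.2.
  by apply: ord_inj => /=; rewrite e2 e3 leqnn; case: ifP; lia.
rewrite /base /flipped -(ord_inj e1) -eq_fold; split=> //; split=> //=.
by rewrite e2; case: ifP; lia.
Qed.

Hypotheses (t1_gt0 : 0 < t1) (t2_gt0 : 0 < t2).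
Variable B : {set 'I_t1 * 'I_t2}.

Hypothesis Blow : forall p q : 'I_t1 * 'I_t2,
  p \in B -> q \notin B -> p.1 + p.2 <= q.1 + q.2.
Hypothesis s0 : forall v (p : 'I_t1 * 'I_t2), p.1 = 0 :> nat -> p.2 = 0 :> nat ->
  (s v p).1 = 0 :> nat /\ (s v p).2 = 0 :> nat.
Hypothesis sB : forall v p, (s v p \in B) = frame p.
Hypothesis sl : forall p : 'I_t1 * 'I_t2, p.2 = t2.-1 :> nat ->
  (s false p).1 = 0 :> nat \/ (s true p).1 = 0 :> nat.

(** The defects are all central because of [sl], and the boundary values are the
    reflected copies of the ball [B], a lower set for the distance to the centre. *)
Lemma arrangement_optimal : optimal_family arrangement.
Proof.
have ev1 : ~~ odd n1 by rewrite odd_double.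
have ev2 : ~~ odd n2 by rewrite odd_double.
have n1_gt1 : 1 < n1 by lia.
have n2_gt1 : 1 < n2 by lia.
split.
- apply/eqP; rewrite eqEcard card_corner_values // card_Lambda1 // andbT.
  apply/subsetP => y /imsetP[x]; rewrite inE => /andP[eR eC] ->.
  rewrite Lambda1E inE /cdist2 cdist_row_arrangement cdist_col_arrangement.
  by have [b1 b2] := base_corner eR eC; have [-> ->] := s0 (in_right_half x) b1 b2.
- left; exists [set x | small Col x].
  have inH x : (x \in [set x | small Col x]) = ~~ in_right_half x.
    by rewrite inE /small /half /in_right_half /= doubleK -ltnNge.
  split=> [|x|x|[x y] xy]; [by left | by rewrite inH homogeneous_arrangement.. | ].
  rewrite !inH => /(congr1 negb); rewrite !negbK => eq_r.
  have := edge_arrangement xy; rewrite eq_r eqxx /= => fl [].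
    by rewrite !small_row_arrangement fl; case: (flipped x).
  by rewrite !small_col_arrangement eq_r fl; case: (flipped x) (in_right_half y) => [] [].
- apply/(defectsP ev1 ev2) => -[x y] xy i /=; have := edge_arrangement xy.
  rewrite /central_defect; case: eqP => [eq_r fl | /eqP neq_r [eq_b [fl last]]].
    case: i; rewrite ?small_row_arrangement ?small_col_arrangement ?eq_r fl.
      by case: (flipped x).
    by case: (flipped x) (in_right_half y) => [] [].
  case: i; rewrite ?small_row_arrangement ?small_col_arrangement fl.
    rewrite eqxx /= !cdist_row_arrangement eq_b.
    move: neq_r; case: (in_right_half x) (in_right_half y) => [] [] // _;
    by case: (sl last) => ->; rewrite ?minn1 ?min1n //; lia.
  by move: neq_r; case: (flipped x) (in_right_half x) (in_right_half y) => [] [] [].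
apply/eqP; rewrite eq_le -/(boundary_values arrangement) boundary_weight // andbT.
have [|[A cA <-] _] := @min_weightP n1 n2 (2 * n1 + 2 * n2 - 4).
  by have := leq_mul n1_gt1 n2_gt1; nia.
apply: lower_set_min; last by rewrite card_boundary_values.
move=> x y; rewrite -[x](permKV arrangement) -[y](permKV arrangement).
move: (arrangement^-1 x)%g (arrangement^-1 y)%g => {}x {}y.
have inb z : (arrangement z \in boundary_values arrangement) = (s (in_right_half z) (base z) \in B).
  rewrite boundary_valuesE mem_imset ?inE; last exact: perm_inj.
  by rewrite sB frame_base.
rewrite !inb => /Blow le_B /le_B le_xy.
rewrite !dist_center ler_pM2r // ler_nat /cdist2.
rewrite !(cdist_row_arrangement, cdist_col_arrangement).
by rewrite !addSn !addnS -!doubleD !ltnS leq_double.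
Qed.
End Construction.

Lemma optimal_family_nonempty n1 n2 :
    0 < n1 -> ~~ odd n1 -> ~~ odd n2 -> n1 <= n2 ->
    n1 < n2 \/ n1 = n2 /\ n1 \notin [:: 4; 8; 12; 16] ->
  exists s : {perm grid n1 n2}, optimal_family s.
Proof.
move=> n1_gt0 /negbTE ev1 /negbTE ev2 le_n n12.
have n1E : n1 = n1./2.*2 by rewrite -[LHS]odd_double_half ev1.
have n2E : n2 = n2./2.*2 by rewrite -[LHS]odd_double_half ev2.
have t12 : n1./2 < n2./2 \/ n1./2 = n2./2 /\ n1./2 \notin [:: 2; 4; 6; 8].
  by move: n12; rewrite !inE; lia.
have t1_gt0 : 0 < n1./2 by lia.
have le_t : n1./2 <= n2./2 by lia.
have t2_gt0 : 0 < n2./2 by lia.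
rewrite n1E n2E.
have [B [s [Blow s0 sB sl]]] := quadrant_perms t1_gt0 le_t t12.
by exists (arrangement s); exact: arrangement_optimal Blow s0 sB sl.
Qed.

(** * The maximum *)

Local Open Scope ring_scope.

Theorem theorem3p7 (n1 n2 : nat)
    (n1_gt0 : (0 < n1)%N) (n2_gt0 : (0 < n2)%N)
    (n1_even : ~~ odd n1) (n2_even : ~~ odd n2)
    (n1_le_n2 : (n1 <= n2)%N)
    (n12 : (n1 < n2)%N \/ (n1 = n2 /\ n1 \notin [:: 4; 8; 12; 16]%N)) :
  [/\ exists s : {perm grid n1 n2}, optimal_family s,
      forall s : {perm grid n1 n2},
        (forall s' : {perm grid n1 n2}, f s' <= f s) <-> optimal_family s
    & exists2 s : {perm grid n1 n2},
        f s = n1%:R * n2%:R * (n1%:R + n2%:R) - 4 - n1%:R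
              - min_weight n1 n2 (2 * n1 + 2 * n2 - 4)
      & forall s' : {perm grid n1 n2}, f s' <= f s].
Proof.
have n1_gt1 : (1 < n1)%N by lia.
have bound (s : {perm grid n1 n2}) := f_bound n1_gt1 n1_le_n2 n1_even n2_even s.
have [s0 opt0] : exists s : {perm grid n1 n2}, optimal_family s.
  exact: optimal_family_nonempty.
have max0 := (bound s0).2.2 opt0.
split; first by exists s0.
  move=> s; split=> [s_max | /(bound s).2 fs s']; last by rewrite fs (bound s').1.
  by apply/(bound s).2/le_anti; rewrite (bound s).1 -max0 s_max.
by exists s0 => // s'; rewrite max0 (bound s').1.
Qed.
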